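(* Let $0<\delta<1$ be any constant. Consider an arrangement of $n$ pseudolines in which every crossing involves at most $\delta n$ pseudolines. Then there exist $\Omega(n)$ pseudolines whose local sequences have length (half-period) $\Omega(n)$. That is, for every $\delta\in(0,1)$ there are constants $a,b>0$ and $n_0$, depending only on $\delta$, such that for every $n\ge n_0$ and every arrangement of $n$ pseudolines in which each crossing point is incident to at most $\delta n$ pseudolines, at least $an$ of the pseudolines have a local sequence of length at least $bn$.
   Context: An (Euclidean) arrangement of $n$ pseudolines is a family of $n$ two-way infinite $x$-monotone curves in the plane $\mathbb{R}^2$ such that any two of the curves have precisely one point in common, at which they properly cross. Three or more pseudolines may pass through a common point. A crossing point is a point lying on at least two of the pseudolines; the crossing involves all the pseudolines passing through that point. The local sequence of a pseudoline is the sequence of crossings (reversals, in the associated sequence of permutations obtained by a left-to-right sweep) in which it is involved, listed from left to right; its length (also called half-period) is the number of these crossings, i.e. the number of distinct crossing points of the arrangement lying on that pseudoline. *)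

(* Defs.v *)
From mathcomp Require Import all_boot all_order all_algebra finmap.
From mathcomp Require Import all_classical all_reals all_analysis.
Set Implicit Arguments.
Unset Strict Implicit.
Unset Printing Implicit Defensive.
Import Order.TTheory GRing.Theory Num.Theory numFieldNormedType.Exports.
Local Open Scope classical_set_scope.
Local Open Scope ring_scope.

Section Pseudolines.
Variable R : realType.

(* A two-way infinite x-monotone curve is the graph of a continuous function
   R -> R; the points of the plane are the pairs p : R * R. *)
Definition curve (f : R -> R) : set (R * R) := [set p | p.2 = f p.1].

(* The two curves exchange their vertical order at abscissa x. *)
Definition crosses_at (f g : R -> R) (x : R) : Prop :=
  ((\forall y \near x^'-, f y < g y) /\ (\forall y \near x^'+, g y < f y)) \/
  ((\forall y \near x^'-, g y < f y) /\ (\forall y \near x^'+, f y < g y)).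

Definition pseudoline_arrangement (n : nat) (f : 'I_n -> R -> R) : Prop :=
  (forall i, continuous (f i)) /\
  (forall i j, i != j -> exists p : R * R,
     curve (f i) `&` curve (f j) = [set p] /\ crosses_at (f i) (f j) p.1).

Definition lines_through (n : nat) (f : 'I_n -> R -> R) (p : R * R) :
    {set 'I_n} :=
  [set i : 'I_n | p \in curve (f i)]%SET.

Definition crossing_point (n : nat) (f : 'I_n -> R -> R) (p : R * R) : Prop :=
  (2 <= #|lines_through f p|)%N.

Definition crossings_on (n : nat) (f : 'I_n -> R -> R) (i : 'I_n) :
    set (R * R) :=
  [set p | crossing_point f p /\ curve (f i) p].

(* fset_set A is the finite set with the elements of A when A is finite (and
   empty otherwise); in an arrangement crossings_on f i is always finite, see
   mem_local_sequence below. *)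
Definition local_sequence (n : nat) (f : 'I_n -> R -> R) (i : 'I_n) :
    seq (R * R) :=
  sort (fun p q => p.1 <= q.1) (fset_set (crossings_on f i)).

Definition half_period (n : nat) (f : 'I_n -> R -> R) (i : 'I_n) : nat :=
  size (local_sequence f i).

Lemma finite_crossings_on (n : nat) (f : 'I_n -> R -> R) (i : 'I_n) :
  pseudoline_arrangement f -> finite_set (crossings_on f i).
Proof.
move=> [_ fX].
pose D := [set j : 'I_n | i != j].
apply: (@sub_finite_set _ _ (\bigcup_(j in D) (curve (f i) `&` curve (f j)))).
  move=> p [/card_gt1P[j [k [jp kp jk]]] ip].
  have [ij|ij] := eqVneq i j.
    exists k; first by rewrite /D /= ij.
    by split => //; move: kp; rewrite !inE.
  by exists j => //; split => //; move: jp; rewrite !inE.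
apply: bigcup_finite; first exact: finite_finset.
by move=> j /fX[p [-> _]]; exact: finite_set1.
Qed.

Lemma mem_local_sequence (n : nat) (f : 'I_n -> R -> R) (i : 'I_n) (p : R * R) :
  pseudoline_arrangement f ->
  (p \in local_sequence f i) = (p \in crossings_on f i).
Proof.
by move=> fA; rewrite mem_sort in_fset_set//; exact: finite_crossings_on.
Qed.

Lemma uniq_local_sequence (n : nat) (f : 'I_n -> R -> R) (i : 'I_n) :
  uniq (local_sequence f i).
Proof. by rewrite sort_uniq fset_uniq. Qed.

End Pseudolines.

(* Main.v *)
Require Import Defs.
From mathcomp Require Import all_boot all_order all_algebra finmap.
From mathcomp Require Import all_classical all_reals all_analysis.
From mathcomp Require Import ring lra zify.
Import Order.TTheory GRing.Theory Num.Theory numFieldNormedType.Exports.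
Local Open Scope ring_scope.

Set Implicit Arguments.
Unset Strict Implicit.
Unset Printing Implicit Defensive.

(** This is a theorem of Beck type, and the proof follows the route through
    incidence bounds of Szemeredi-Trotter type.

    Call a pseudoline rich if its half-period is at least [b * n], and suppose
    that fewer than [a * n] are rich.  The [n ^ 2] ordered pairs of pseudolines
    are sorted by the multiplicity [k] of the point where the two meet.
    - On a pseudoline that is not rich, fewer than [b * n] points of
      multiplicity below a constant [K] account for at most [K * b * n] pairs:
      few pairs meet at points of low multiplicity.
    - The incidence bound [rich_points_bound] says that at most about
      [n ^ 2 / k ^ 3 + n / k] points have multiplicity at least [k], hence about
      [n ^ 2 / k + n * k] pairs meet at points of multiplicity between [k] and
      [2 * k].  Summed over dyadic [k] between [K] and [c * n] this is a
      geometric series dominated by its two ends, so it is at most a small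
      multiple of [n ^ 2].
    - There is only a bounded number [M] of points of multiplicity above
      [c * n].  At most [M ^ 2] pseudolines pass through two of them; any other
      pseudoline passes through at most one, where it meets at most [delta * n]
      others ([card_pairs_high]).
    Altogether at most [(delta + (1 - delta) / 2) * n ^ 2 + O(n)] pairs are
    accounted for, which is absurd for large [n].

    The incidence bound comes from a crossing inequality for the graph whose
    vertices are some points of the arrangement and whose edges join points that
    are consecutive on a pseudoline ([crossing_inequality]).  Its edges cross at
    most once per pair of pseudolines.  An [x]-monotone drawing without
    crossings has at most [3 * #|V|] edges ([card_plane_drawing]); for this no
    Euler formula is needed, since each edge can be charged to a vertex in one
    of three injective ways ([sees_or_lowest]): to a vertex visible vertically
    below it, to its left end if it is the lowest edge leaving that end to the
    right, or symmetrically to its right end.  The passage from plane drawings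
    to drawings with crossings is the usual sampling argument, with the random
    sample replaced by the average over all colourings of the vertices with [m]
    colours. *)

(** * Families of curves crossing once *)

Section CrossOnce.
Variables (R : realType) (L : eqType).
Implicit Types (g h : R -> R) (f : L -> R -> R).

Definition switches g h (x0 : R) : Prop :=
  (forall x, x < x0 -> g x < h x) /\ (forall x, x0 < x -> h x < g x).

(** The order-theoretic content of a pseudoline arrangement: everything up to the
    counting of pairs uses only this. *)
Definition cross_once f : Prop :=
  forall i j, i != j -> exists x0, f i x0 = f j x0 /\
    (switches (f i) (f j) x0 \/ switches (f j) (f i) x0).

Lemma agree_once f i j x y : cross_once f -> i != j ->
  f i x = f j x -> f i y = f j y -> x = y.
Proof.
move=> fX ij ex ey; have [x0 [e0 H]] := fX _ _ ij.
suff K z : f i z = f j z -> z = x0 by rewrite (K x) // (K y).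
move=> ez; case: (ltgtP z x0) => // zx; case: H => -[H1 H2].
- by have := H1 _ zx; rewrite ez ltxx.
- by have := H1 _ zx; rewrite ez ltxx.
- by have := H2 _ zx; rewrite ez ltxx.
- by have := H2 _ zx; rewrite ez ltxx.
Qed.

Lemma switches_of_lt f i j x y : cross_once f -> f i x = f j x ->
  x < y -> f i y < f j y -> switches (f j) (f i) x.
Proof.
move=> fX ex xy lt; have ij : i != j by apply: contraTneq lt => ->; rewrite ltxx.
have [x0 [e0 H]] := fX _ _ ij; have {e0}E := agree_once fX ij ex e0; subst x0.
by case: H => // -[_ /(_ _ xy)]; rewrite ltNge (ltW lt).
Qed.

(** Two curves that do not meet strictly between [x] and [y] keep their weak
    order; [x] may lie on either side of [y]. *)
Lemma no_cross_le f i j x y : cross_once f -> f i x < f j x ->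
  (forall z, Num.min x y < z < Num.max x y -> f i z <> f j z) ->
  f i y <= f j y.
Proof.
move=> fX lt nz; rewrite leNgt; apply/negP => gt.
have ij : i != j by apply: contraTneq lt => ->; rewrite ltxx.
have [x0 [e0 H]] := fX _ _ ij; apply: (nz x0) => //.
have nx : x0 != x by apply: contraTneq lt => <-; rewrite e0 ltxx.
have ny : x0 != y by apply: contraTneq gt => <-; rewrite e0 ltxx.
rewrite gt_min lt_max.
case: H => -[H1 H2]; case: (ltgtP x0 x) nx => // xx _;
  case: (ltgtP x0 y) ny => // yy _ //=.
- by have := H2 _ xx; rewrite ltNge (ltW lt).
- by have := H1 _ yy; rewrite ltNge (ltW gt).
- by have := H2 _ yy; rewrite ltNge (ltW gt).
- by have := H1 _ xx; rewrite ltNge (ltW lt).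
Qed.

Lemma cross_once_mirror f : cross_once f -> cross_once (fun l x => f l (- x)).
Proof.
move=> fX i j ij; have [x0 [e0 H]] := fX _ _ ij.
exists (- x0); rewrite opprK; split=> //.
case: H => -[H1 H2]; [right|left]; split=> x xx;
  first [apply: H1 | apply: H2]; lra.
Qed.

Lemma continuous_same_sign g h (s : set R) :
  continuous g -> continuous h ->
  (forall x y z, s x -> s y -> x <= z <= y -> s z) ->
  (forall x, s x -> g x <> h x) ->
  forall x y, s x -> s y -> g x < h x -> g y < h y.
Proof.
move=> gc hc sI ne x y sx sy lt; rewrite ltNge; apply/negP => ge.
pose d := fun z : R => g z - h z.
have dc a b : {within `[a, b], continuous d}%classic.
  by apply: continuous_subspaceT => z; apply: cvgB; [exact: gc|exact: hc].
have hx : d x <= 0 by rewrite /d; lra.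
have hy : 0 <= d y by rewrite /d; lra.
have [xy|/ltW yx] := leP x y.
  have [|c /itvP cI dc0] := @IVT R d x y 0 xy (dc x y).
    by rewrite ge_min le_max hx hy orbT.
  by apply: (ne c); [apply: (sI x y) => //; rewrite !cI | move: dc0; rewrite /d; lra].
have [|c /itvP cI dc0] := @IVT R d y x 0 yx (dc y x).
  by rewrite ge_min le_max hx hy orbT.
by apply: (ne c); [apply: (sI y x) => //; rewrite !cI | move: dc0; rewrite /d; lra].
Qed.

End CrossOnce.

Section Arrangement.
Local Open Scope classical_set_scope.
Local Open Scope ring_scope.

(** By the intermediate value theorem the difference of two pseudolines has a
    constant sign on each side of their only common point, and the crossing
    condition near that point says that the two signs differ. *)
Lemma arrangement_cross_once (R : realType) (n : nat) (f : 'I_n -> R -> R) :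
  pseudoline_arrangement f -> cross_once f.
Proof.
move=> [fc fX] i j ij; have [p [pE pX]] := fX i j ij; exists p.1.
have : (curve (f i) `&` curve (f j)) p by rewrite pE.
rewrite /curve /= => -[pi pj]; split; first by rewrite -pi.
have ne x : x != p.1 -> f i x <> f j x.
  move=> /eqP xp e; apply: xp.
  have : (curve (f i) `&` curve (f j)) (x, f i x) by split.
  by rewrite pE /= => <-.
have left_of (g h : R -> R) : continuous g -> continuous h ->
    (forall x, x != p.1 -> g x <> h x) ->
    (\forall y \near p.1^'-, g y < h y) -> forall x, x < p.1 -> g x < h x.
  move=> gc hc gh nr x xp.
  have [y [yp yl]] : exists y, y < p.1 /\ g y < h y.
    have /filter_ex[y [? ?]] : \forall y \near p.1^'-, y < p.1 /\ g y < h y.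
      by apply: filterS2 nr (nbhs_left_lt p.1) => z; split.
    by exists y.
  apply: (@continuous_same_sign R g h [set z | z < p.1] gc hc _ _ y x) => //=.
    by move=> a b z _ bp /andP[_ /le_lt_trans]; apply.
  by move=> z zp; apply: gh; rewrite lt_eqF.
have right_of (g h : R -> R) : continuous g -> continuous h ->
    (forall x, x != p.1 -> g x <> h x) ->
    (\forall y \near p.1^'+, g y < h y) -> forall x, p.1 < x -> g x < h x.
  move=> gc hc gh nr x xp.
  have [y [yp yl]] : exists y, p.1 < y /\ g y < h y.
    have /filter_ex[y [? ?]] : \forall y \near p.1^'+, p.1 < y /\ g y < h y.
      by apply: filterS2 nr (nbhs_right_gt p.1) => z; split.
    by exists y.
  apply: (@continuous_same_sign R g h [set z | p.1 < z] gc hc _ _ y x) => //=.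
    by move=> a b z ap _ /andP[/(lt_le_trans ap)].
  by move=> z zp; apply: gh; rewrite gt_eqF.
have ne' x : x != p.1 -> f j x <> f i x by move=> /ne xp /esym.
case: pX => -[pl pr]; [left|right]; split.
- exact: left_of pl.
- exact: right_of pr.
- exact: left_of pl.
- exact: right_of pr.
Qed.

End Arrangement.

(** * Plane monotone drawings have few edges *)

Section PlaneDrawing.
Variables (R : realType) (L V : finType) (A : {set V}).
Implicit Types (f : L -> R -> R) (px py : V -> R) (E : L -> V -> V -> bool).

(** A triple [E l u v] is the arc of the curve [l] from the vertex [u] rightwards
    to the vertex [v].  Arcs avoid the vertices in their interior and two arcs of
    different curves may only meet at a common end. *)
Record plane_drawing f px py E : Prop := PlaneDrawing {
  draw_inj : forall u v, px u = px v -> py u = py v -> u = v;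
  draw_in : forall l u v, E l u v -> u \in A /\ v \in A;
  draw_on : forall l u v, E l u v -> py u = f l (px u) /\ py v = f l (px v);
  draw_lt : forall l u v, E l u v -> px u < px v;
  draw_empty : forall l u v w, E l u v -> w \in A -> py w = f l (px w) ->
    px u < px w -> px w < px v -> False;
  draw_plane : forall l u v l' u' v' x, E l u v -> E l' u' v' -> l != l' ->
    px u < x < px v -> px u' < x < px v' -> f l x <> f l' x }.

(** The arc is the first one met by the vertical ray going up from [w]. *)
Definition sees f px py E (w : V) l u v : Prop :=
  [/\ px u < px w < px v, py w < f l (px w) &
    forall l' u' v', E l' u' v' -> px u' < px w < px v' ->
      py w < f l' (px w) -> f l (px w) <= f l' (px w)].

(** Two arcs leaving [u] to the right never meet again, so comparing them at any
    abscissa to the right of [u], such as that of [v], compares them everywhere. *)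
Definition lowest_from_left f px E l u v : Prop :=
  forall l' v', E l' u v' -> f l (px v) <= f l' (px v).

(** Let [(l1, u, v1)] be the arc immediately below [(l, u, v)] at their common left
    end, and suppose that it ends first.  Then the leftmost vertex [w] in the
    corner between the two arcs sees [(l, u, v)]: an arc blocking the view could be
    followed to the left inside the corner, where it would end at a vertex further
    to the left than [w] or at [u], between two neighbouring arcs. *)
Lemma sees_from_left_corner f px py E l u v l1 v1 :
  cross_once f -> plane_drawing f px py E -> E l u v -> E l1 u v1 ->
  f l1 (px v) < f l (px v) ->
  (forall l2 v2, E l2 u v2 -> f l2 (px v) < f l (px v) ->
     f l2 (px v) <= f l1 (px v)) ->
  px v1 < px v -> exists2 w, w \in A & sees f px py E w l u v.
Proof.
move=> fX D Ee Eg gv gmax v1v.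
have [eu ev] := draw_on D Ee; have uv := draw_lt D Ee.
have [gu gv1] := draw_on D Eg; have uv1 := draw_lt D Eg.
have [uA v1A] := draw_in D Eg.
have below : forall z, px u < z -> f l1 z < f l z.
  by apply: (switches_of_lt fX _ uv gv).2; rewrite -eu.
pose T w := [&& w \in A, px u < px w <= px v1 & f l1 (px w) <= py w < f l (px w)].
have T1 : T v1 by rewrite /T v1A uv1 lexx gv1 lexx below.
case: (arg_minP px T1) => w /and3P[wA /andP[uw wv1] /andP[gw we]] wmin.
exists w => //; split=> //; first by rewrite uw (le_lt_trans wv1).
move=> l' u' v' Eh /andP[u'w wv'] wh; rewrite leNgt; apply/negP => he.
have ll' : l' != l by apply: contraTneq he => ->; rewrite ltxx.
have l1l' : l1 != l' by apply: contraTneq wh => <-; rewrite ltNge gw.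
have gh : f l1 (px w) < f l' (px w) by exact: le_lt_trans wh.
have [hu hv] := draw_on D Eh.
(* Followed to the left, the blocking arc stays in the corner until it ends. *)
have stay z : px u <= z -> px u' <= z -> z < px w ->
    f l1 z <= f l' z /\ f l' z <= f l z.
  move=> uz u'z zw; split.
    apply: (no_cross_le fX gh) => t; rewrite min_r ?max_l ?(ltW zw)// => /andP[zt tw].
    by apply: (draw_plane D Eg Eh l1l'); lra.
  apply: (no_cross_le fX he) => t; rewrite min_r ?max_l ?(ltW zw)// => /andP[zt tw].
  by apply: (draw_plane D Eh Ee ll'); lra.
have [uu'|u'u] := ltP (px u) (px u').
  have [g1 g2] := stay (px u') (ltW uu') (lexx _) u'w.
  suff /wmin : T u' by lra.
  have [u'A _] := draw_in D Eh.
  have u'v : px u' < px v by lra.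
  rewrite /T u'A uu' hu g1 lt_neqAle g2 andbT (ltW (lt_le_trans u'w wv1)) /=.
  apply/eqP => e; apply: (draw_empty D Ee u'A _ uu' u'v); first by rewrite hu e.
have [g1 g2] := stay (px u) (lexx _) u'u uw.
have hu' : py u = f l' (px u) by lra.
have ue : px u' = px u.
  apply/eqP; rewrite eq_le u'u leNgt; apply/negP => lt.
  by apply: (draw_empty D Eh uA hu' lt); lra.
have u'E : u' = u by apply: (draw_inj D); rewrite // hu hu' ue.
subst u'.
have hv' := (switches_of_lt fX (esym (etrans (esym eu) hu')) uw he).2 _ uv.
have := gmax _ _ Eh hv'.
have := (switches_of_lt fX (etrans (esym gu) hu') uw gh).2 _ uv; lra.
Qed.

Lemma highest_below_from_left f px E l u v :
  ~ lowest_from_left f px E l u v ->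
  exists l1 v1, [/\ E l1 u v1, f l1 (px v) < f l (px v) &
    forall l2 v2, E l2 u v2 -> f l2 (px v) < f l (px v) ->
      f l2 (px v) <= f l1 (px v)].
Proof.
move=> nl.
have [[l0 v0] P0] : exists g : L * V, E g.1 u g.2 && (f g.1 (px v) < f l (px v)).
  apply: contra_notP nl => nl l' v' El'; rewrite leNgt; apply/negP => lt.
  by apply: nl; exists (l', v'); rewrite El'.
pose P (g : L * V) := E g.1 u g.2 && (f g.1 (px v) < f l (px v)).
have {}P0 : P (l0, v0) by [].
case: (arg_maxP (fun g => f g.1 (px v)) P0) => -[l1 v1] /andP[/= E1 lt1] mx.
exists l1, v1; split=> // l2 v2 E2 lt2.
by apply: (mx (l2, v2)); rewrite /P /= E2.
Qed.

(** Of two arcs leaving [u] on different curves one is strictly lower all along, and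
    of two arcs leaving [u] on the same curve the longer one would contain an end
    of the shorter one. *)
Lemma lowest_from_left_inj f px py E l u v l' v' :
  cross_once f -> plane_drawing f px py E -> E l u v -> E l' u v' ->
  lowest_from_left f px E l u v -> lowest_from_left f px E l' u v' ->
  (l, u, v) = (l', u, v').
Proof.
move=> fX D Ee Ee' lo lo'.
have [eu ev] := draw_on D Ee; have uv := draw_lt D Ee.
have [eu' ev'] := draw_on D Ee'; have uv' := draw_lt D Ee'.
have := lo _ _ Ee'; have := lo' _ _ Ee.
have [ll'|ll'] := eqVneq l l'; last first.
  move=> le1 le2; exfalso; move: le2; rewrite le_eqVlt => /orP[/eqP e|lt].
    by have := agree_once fX ll' e (etrans (esym eu) eu'); lra.
  by have := (switches_of_lt fX (etrans (esym eu) eu') uv lt).2 _ uv'; lra.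
subst l' => _ _; congr (_, _, _).
have [_ vA] := draw_in D Ee; have [_ vA'] := draw_in D Ee'.
case: (ltgtP (px v) (px v')) => [vv'|v'v|e].
- by case: (draw_empty D Ee' vA ev uv vv').
- by case: (draw_empty D Ee vA' ev' uv' v'v).
- by apply: (draw_inj D) => //; rewrite ev ev' e.
Qed.

(** Arcs of one curve have disjoint interiors because they contain no vertex. *)
Lemma same_line_edges f px py E l u v u' v' x : plane_drawing f px py E ->
  E l u v -> E l u' v' -> px u < x < px v -> px u' < x < px v' ->
  u = u' /\ v = v'.
Proof.
move=> D Ee Ee' /andP[ux xv] /andP[u'x xv'].
have [eu ev] := draw_on D Ee; have [eu' ev'] := draw_on D Ee'.
have [uA vA] := draw_in D Ee; have [uA' vA'] := draw_in D Ee'.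
split; apply: (draw_inj D).
- case: (ltgtP (px u) (px u')) => // lt.
    by case: (draw_empty D Ee uA' eu' lt); lra.
  by case: (draw_empty D Ee' uA eu lt); lra.
- rewrite eu eu'; congr (f l _); case: (ltgtP (px u) (px u')) => // lt.
    by case: (draw_empty D Ee uA' eu' lt); lra.
  by case: (draw_empty D Ee' uA eu lt); lra.
- case: (ltgtP (px v) (px v')) => // lt.
    by case: (draw_empty D Ee' vA ev _ lt); lra.
  by case: (draw_empty D Ee vA' ev' _ lt); lra.
- rewrite ev ev'; congr (f l _); case: (ltgtP (px v) (px v')) => // lt.
    by case: (draw_empty D Ee' vA ev _ lt); lra.
  by case: (draw_empty D Ee vA' ev' _ lt); lra.
Qed.

(** A vertex is charged at most once through visibility: two arcs seen from [w]
    would have the same height above [w], that is, meet in their interiors. *)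
Lemma sees_inj f px py E w l u v l' u' v' : plane_drawing f px py E ->
  E l u v -> E l' u' v' -> sees f px py E w l u v -> sees f px py E w l' u' v' ->
  (l, u, v) = (l', u', v').
Proof.
move=> D Ee Ee' [xe we lo] [xe' we' lo'].
have e : f l (px w) = f l' (px w).
  by apply: le_anti; rewrite (lo _ _ _ Ee' xe' we') (lo' _ _ _ Ee xe we).
have [ll'|ll'] := eqVneq l l'; last by case: (draw_plane D Ee Ee' ll' xe xe' e).
by subst l'; have [-> ->] := same_line_edges D Ee Ee' xe xe'.
Qed.

(** Reflection in a vertical axis carries the statements about left ends over to
    right ends. *)
Definition flip_lines f : L -> R -> R := fun l x => f l (- x).
Definition flip_pos px : V -> R := fun v => - px v.
Definition flip_edges E : L -> V -> V -> bool := fun l u v => E l v u.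

Lemma plane_drawing_flip f px py E : plane_drawing f px py E ->
  plane_drawing (flip_lines f) (flip_pos px) py (flip_edges E).
Proof.
move=> D; split; rewrite /flip_lines /flip_pos /flip_edges.
- by move=> u v /oppr_inj; exact: (draw_inj D).
- by move=> l u v /(draw_in D)[].
- by move=> l u v /(draw_on D)[]; rewrite !opprK.
- by move=> l u v /(draw_lt D); rewrite ltrN2.
- move=> l u v w Ee wA; rewrite opprK !ltrN2 => ew h1 h2.
  exact: (draw_empty D Ee wA ew h2 h1).
- move=> l u v l' u' v' x Ee Ee' ll' h h'; apply: (draw_plane D Ee Ee' ll'); lra.
Qed.

Lemma sees_flip f px py E w l u v :
  sees (flip_lines f) (flip_pos px) py (flip_edges E) w l v u ->
  sees f px py E w l u v.
Proof.
rewrite /sees /flip_lines /flip_pos /flip_edges opprK => -[h1 h2 h3]; split=> //.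
  lra.
by move=> l' u' v' Ee h; apply: (h3 _ v' u') => //; lra.
Qed.

Definition lowest_from_right f px E l u v : Prop :=
  lowest_from_left (flip_lines f) (flip_pos px) (flip_edges E) l v u.

(** If the arc [e] is not lowest at either end, its lower neighbours at the two ends
    lie on curves that must cross below [e], since each already meets the curve of
    [e] at an end of [e].  In a plane drawing one of these neighbours therefore
    ends before the crossing, at a vertex below [e], and the corner lemma applies
    on that side. *)
Lemma sees_or_lowest f px py E l u v :
  cross_once f -> plane_drawing f px py E -> E l u v ->
  [\/ exists2 w, w \in A & sees f px py E w l u v,
      lowest_from_left f px E l u v | lowest_from_right f px E l u v].
Proof.
move=> fX D Ee.
have [lo|] := pselect (lowest_from_left f px E l u v); first by constructor 2.
move=> /highest_below_from_left[l1 [v1 [E1 lt1 mx1]]].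
have [lo|] := pselect (lowest_from_right f px E l u v); first by constructor 3.
move=> /highest_below_from_left[l2 [u2 [E2 lt2 mx2]]].
have [v1v|vv1] := ltP (px v1) (px v).
  by constructor 1; exact: (sees_from_left_corner fX D Ee E1 lt1 mx1 v1v).
have fX' := cross_once_mirror fX; have D' := plane_drawing_flip D.
have [uu2|u2u] := ltP (px u) (px u2).
  constructor 1; have [|w wA ws] := sees_from_left_corner fX' D' Ee E2 lt2 mx2.
    by rewrite /flip_pos ltrN2.
  by exists w => //; apply: sees_flip.
exfalso; move: E2 lt2; rewrite /flip_edges /flip_lines /flip_pos opprK => E2 lt2.
have [eu ev] := draw_on D Ee; have uv := draw_lt D Ee.
have [gu gv] := draw_on D E1; have [hu hv] := draw_on D E2.
have l12 : l1 != l2.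
  by apply: contraTneq lt1 => ->; rewrite -ev hv ltxx.
have : f l2 (px u) < f l1 (px u) by rewrite -gu eu.
have nz z : Num.min (px u) (px v) < z < Num.max (px u) (px v) -> f l2 z <> f l1 z.
  rewrite min_l ?max_r ?(ltW uv)// => /andP[uz zv] /esym.
  by apply: (draw_plane D E1 E2 l12); lra.
move=> /(no_cross_le fX) /(_ nz).
by rewrite -hv ev leNgt lt1.
Qed.

Lemma leq_card_rel (T U : finType) (S : {set T}) (B : {set U}) (r : T -> U -> Prop) :
  (forall t, t \in S -> exists2 u, u \in B & r t u) ->
  (forall t t' u, t \in S -> t' \in S -> r t u -> r t' u -> t = t') ->
  (#|S| <= #|B|)%N.
Proof.
move=> ex inj; have [->|[t0 t0S]] := set_0Vmem S; first by rewrite cards0.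
have [u0 _ _] := ex _ t0S.
have /choice[g gP] t : exists u, t \in S -> u \in B /\ r t u.
  have [tS|tS] := boolP (t \in S); last by exists u0.
  by have [u uB ru] := ex _ tS; exists u.
rewrite -(@card_in_imset _ _ g S); last first.
  move=> t t' tS t'S e; apply: (inj t t' (g t)) => //.
    by case: (gP _ tS).
  by rewrite e; case: (gP _ t'S).
by apply: subset_leq_card; apply/fintype.subsetP => _ /imsetP[t tS ->]; case: (gP _ tS).
Qed.

(** Each of the three charging rules is injective. *)
Lemma card_plane_drawing f px py (EE : {set L * V * V}) : cross_once f ->
  plane_drawing f px py (fun l u v => (l, u, v) \in EE) ->
  (#|EE| <= 3 * #|A|)%N.
Proof.
set E := fun l u v => _ => fX D.
pose S1 := [set e in EE | `[< exists2 w, w \in A & sees f px py E w e.1.1 e.1.2 e.2 >]]%SET.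
pose S2 := [set e in EE | `[< lowest_from_left f px E e.1.1 e.1.2 e.2 >]]%SET.
pose S3 := [set e in EE | `[< lowest_from_right f px E e.1.1 e.1.2 e.2 >]]%SET.
have c1 : (#|S1| <= #|A|)%N.
  apply: (@leq_card_rel _ _ _ _ (fun e w => sees f px py E w e.1.1 e.1.2 e.2)).
    by move=> e; rewrite inE => /andP[_ /asboolP].
  move=> [[l u] v] [[l' u'] v'] w; rewrite !inE => /andP[Ee _] /andP[Ee' _].
  exact: sees_inj.
have c2 : (#|S2| <= #|A|)%N.
  apply: (@leq_card_rel _ _ _ _ (fun e u => e \in S2 /\ u = e.1.2)).
    move=> [[l u] v] eS; exists u => //.
    by move: eS; rewrite inE => /andP[Ee _]; case: (draw_in D Ee).
  move=> [[l u] v] [[l' u'] v'] w /[!inE] /andP[Ee /asboolP lo].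
  move=> /andP[Ee' /asboolP lo'] [_ wu] [_ wu'] /=; move: wu wu' => /= wu wu'; subst.
  exact: (lowest_from_left_inj fX D Ee Ee' lo lo').
have c3 : (#|S3| <= #|A|)%N.
  apply: (@leq_card_rel _ _ _ _ (fun e u => e \in S3 /\ u = e.2)).
    move=> [[l u] v] eS; exists v => //.
    by move: eS; rewrite inE => /andP[Ee _]; case: (draw_in D Ee).
  move=> [[l u] v] [[l' u'] v'] w /[!inE] /andP[Ee /asboolP lo].
  move=> /andP[Ee' /asboolP lo'] [_ wu] [_ wu'] /=; move: wu wu' => /= wu wu'; subst.
  have fX' := cross_once_mirror fX; have D' := plane_drawing_flip D.
  by have [-> ->] := lowest_from_left_inj fX' D' Ee Ee' lo lo'.
have : EE \subset (S1 :|: S2 :|: S3)%SET.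
  apply/fintype.subsetP => -[[l u] v] Ee; rewrite !inE Ee /=.
  by case: (sees_or_lowest fX D Ee) => /asboolP -> //; rewrite !orbT.
move=> /subset_leq_card; have := cardsU (S1 :|: S2)%SET S3; have := cardsU S1 S2.
lia.
Qed.

End PlaneDrawing.

(** * The crossing inequality *)

(** The number of colourings giving a fixed set of [r] vertices the colour [ord0] is
    [m.+1 ^ (#|V| - r)]; this is the expectation computation of the sampling
    argument, cleared of denominators. *)
Lemma sum_card_monochromatic (V I : finType) (m r : nat) (S : I -> {set V})
    (B : {set I}) : (forall t, t \in B -> #|S t| = r) ->
  ((\sum_(c : {ffun V -> 'I_m.+1})
      #|[set t in B | S t \subset [set v | c v == ord0]]%SET|) * m.+1 ^ r =
   #|B| * m.+1 ^ #|V|)%N.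
Proof.
move=> Sr.
under eq_bigr => c _ do rewrite -sum1_card big_mkcond.
rewrite exchange_big /= big_distrl /= -sum1_card big_distrl /=.
rewrite [RHS]big_mkcond /=; apply: eq_bigr => t _.
have [tB|tB] := boolP (t \in B); last first.
  by rewrite big1 // => c _; rewrite inE (negPf tB).
rewrite -big_mkcond sum1_card -(cardsC (S t)) (Sr _ tB) mul1n expnD mulnC.
congr (_ * _)%N.
have := card_pffun_on (@ord0 m) (mem (~: S t)%SET) (mem 'I_m.+1).
rewrite card_ord => <-; apply: eq_card => c; rewrite [LHS]unfold_in /= [LHS]inE tB /=.
apply/fintype.subsetP/pffun_onP => [sub|[sub _] v vS].
  split=> [|? _] //; apply/fintype.subsetP => v; rewrite !inE.
  by apply: contra => /sub; rewrite inE.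
rewrite inE; apply: contraTT vS => /(fintype.subsetP sub).
by rewrite !inE.
Qed.

Section CrossingInequality.
Variables (R : realType) (n : nat) (V : finType).
Variables (f : 'I_n -> R -> R) (px py : V -> R).
Hypothesis fX : cross_once f.
Hypothesis pos_inj : forall u v, px u = px v -> py u = py v -> u = v.

Definition on (l : 'I_n) (v : V) : bool := py v == f l (px v).

Definition consecutive (l : 'I_n) (u v : V) : bool :=
  [&& on l u, on l v, px u < px v &
      [forall w, on l w ==> ~~ (px u < px w < px v)]].

Let edge := ('I_n * V * V)%type.

Definition edges : {set edge} := [set e | consecutive e.1.1 e.1.2 e.2]%SET.

Definition cross (e h : edge) : Prop := exists x,
  [/\ px e.1.2 < x < px e.2, px h.1.2 < x < px h.2 & f e.1.1 x = f h.1.1 x].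

(** The order condition on the curves counts every crossing once. *)
Definition crossing_pairs : {set edge * edge} :=
  [set eh : edge * edge | [&& eh.1 \in edges, eh.2 \in edges,
     (eh.1.1.1 < eh.2.1.1)%N & `[< cross eh.1 eh.2 >]]]%SET.

Definition ends (e : edge) : {set V} := [set e.1.2; e.2]%SET.

Lemma edges_drawing (A : {set V}) (EE : {set edge}) :
  (forall e, e \in EE -> e \in edges /\ ends e \subset A) ->
  (forall e h, e \in EE -> h \in EE -> e.1.1 != h.1.1 -> ~ cross e h) ->
  plane_drawing A f px py (fun l u v => (l, u, v) \in EE).
Proof.
move=> sub nc; split=> //.
- by move=> l u v /sub[_ /fintype.subsetP h]; split; apply: h; rewrite !inE eqxx ?orbT.
- by move=> l u v /sub[]; rewrite inE => /and4P[/eqP ? /eqP ? _ _].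
- by move=> l u v /sub[]; rewrite inE => /and4P[].
- move=> l u v w /sub[]; rewrite inE => /and4P[_ _ _ /forallP/(_ w)] h _ _ /eqP ew uw wv.
  by move: h; rewrite /on ew uw wv.
- move=> l u v l' u' v' x Ee Ee' ll' h h' e; apply: (nc _ _ Ee Ee' ll').
  by exists x.
Qed.

Lemma edges_on_line_disjoint l u v u' v' x :
  (l, u, v) \in edges -> (l, u', v') \in edges ->
  px u < x < px v -> px u' < x < px v' -> u = u' /\ v = v'.
Proof.
pose EE := [set e in edges | e.1.1 == l]%SET.
have D : plane_drawing [set: V]%SET f px py (fun l u v => (l, u, v) \in EE).
  apply: edges_drawing => [e|e h]; first by rewrite inE => /andP[]; rewrite finset.subsetT.
  by rewrite !inE => /andP[_ /eqP ->] /andP[_ /eqP ->]; rewrite eqxx.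
by move=> e1 e2; apply: (same_line_edges D (l := l)); rewrite /= inE ?e1 ?e2 eqxx.
Qed.

Lemma card_crossing_pairs : (#|crossing_pairs| <= n ^ 2)%N.
Proof.
rewrite -(@card_in_imset _ _ (fun eh : edge * edge => (eh.1.1.1, eh.2.1.1))).
  by apply: leq_trans (max_card _) _; rewrite card_prod card_ord.
move=> [[[l1 u1] v1] [[l2 u2] v2]] [[[l1' u1'] v1'] [[l2' u2'] v2']] /= /[1!inE].
move=> /and4P[/= e1 e2 lt /asboolP[x [/= x1 x2 ex]]] /[1!inE].
move=> /and4P[/= e1' e2' lt' /asboolP[x' [/= x1' x2' ex']]] [? ?]; subst l1' l2'.
have l12 : l1 != l2 by apply: contraTneq lt => ->; rewrite ltnn.
have xx := agree_once fX l12 ex ex'; subst x'.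
have [-> ->] := edges_on_line_disjoint e1 e1' x1 x1'.
by have [-> ->] := edges_on_line_disjoint e2 e2' x2 x2'.
Qed.

Lemma card_ends e : e \in edges -> #|ends e| = 2.
Proof.
rewrite inE => /and4P[_ _ lt _]; rewrite cards2.
by have -> : e.1.2 != e.2 by apply: contraTneq lt => ->; rewrite ltxx.
Qed.

(** Two curves through a common vertex do not cross elsewhere, so crossing arcs have
    no common end; their crossing survives sampling with probability the fourth
    power of that of a vertex. *)
Lemma card_ends_crossing eh : eh \in crossing_pairs ->
  #|(ends eh.1 :|: ends eh.2)%SET| = 4.
Proof.
case: eh => [[[l u] v] [[l' u'] v']]; rewrite inE => /and4P[/= e e' lt].
move=> /asboolP[x [/= /andP[ux xv] /andP[ux' xv'] ex]].
rewrite cardsU !card_ends // -[RHS]subn0; congr subn; apply/eqP.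
rewrite cards_eq0; apply/eqP/setP => w; rewrite !inE /=; apply/negP.
move=> /andP[]; have ll' : l != l' by apply: contraTneq lt => ->; rewrite ltnn.
have K z : on l z -> on l' z -> px z = x.
  move=> /eqP h /eqP h'; apply: (agree_once fX ll' _ ex); by rewrite -h h'.
move: e e'; rewrite !inE => /and4P[/= onu onv _ _] /and4P[/= onu' onv' _ _].
have {K onu onv onu' onv'} : forall z, z \in [set u; v]%SET -> z \in [set u'; v']%SET -> px z = x.
  by move=> z; rewrite !inE => /orP[]/eqP-> /orP[]/eqP e; apply: K; rewrite // e.
move=> /(_ w); rewrite !inE => K h h'; have {K h'} wx := K h h'.
by case/orP: h => /eqP e; subst w; lra.
Qed.

(** Removing one arc from each crossing leaves a plane drawing. *)
Lemma card_edges_sample (A : {set V}) :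
  (#|[set e in edges | ends e \subset A]%SET| <= 3 * #|A| +
   #|[set eh in crossing_pairs | (ends eh.1 :|: ends eh.2)%SET \subset A]%SET|)%N.
Proof.
set EA := [set e in edges | _]%SET; set XA := [set eh in crossing_pairs | _]%SET.
set D := [set eh.1 | eh in XA]%SET.
have c1 : (#|EA :\: D| <= 3 * #|A|)%N.
  apply: (card_plane_drawing fX (px := px) (py := py)); apply: edges_drawing.
    by move=> e; rewrite !inE => /andP[_ /andP[]].
  have K e h : e \in (EA :\: D)%SET -> h \in (EA :\: D)%SET ->
      (e.1.1 < h.1.1)%N -> ~ cross e h.
    move=> /setDP[eA eD] /setDP[hA _] lt X; case/negP: eD.
    apply/imsetP; exists (e, h) => //; move: eA hA; rewrite [e \in _]inE [h \in _]inE.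
    move=> /andP[ee es] /andP[hh hs]; rewrite inE finset.subUset es hs inE /= ee hh lt /=.
    by rewrite andbT; apply/asboolP.
  move=> e h eD hD; rewrite neq_ltn => /orP[lt|lt X]; first exact: K.
  apply: (K _ _ hD eD lt); case: X => x [h1 h2 e12].
  by exists x; split.
have c2 : (#|D| <= #|XA|)%N by apply: leq_imset_card.
have c3 : (#|EA :&: D| <= #|D|)%N by rewrite subset_leq_card ?finset.subsetIr.
rewrite -(cardsID D EA) addnC leq_add //; exact: leq_trans c2.
Qed.

(** The inequality of [card_edges_sample] summed over all colourings: vertices, arcs
    and crossings survive with probabilities [1 / m.+1], [1 / m.+1 ^ 2] and
    [1 / m.+1 ^ 4]. *)
Lemma crossing_inequality (m : nat) :
  (m.+1 ^ 2 * #|edges| <= 3 * m.+1 ^ 3 * #|V| + n ^ 2)%N.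
Proof.
pose A (c : {ffun V -> 'I_m.+1}) := [set v | c v == ord0]%SET.
have sE := sum_card_monochromatic m card_ends.
have sX := sum_card_monochromatic m card_ends_crossing.
have sV : ((\sum_c #|A c|) * m.+1 ^ 1 = #|V| * m.+1 ^ #|V|)%N.
  have h v : v \in [set: V]%SET -> #|[set v]%SET| = 1 by rewrite cards1.
  have := sum_card_monochromatic m h; rewrite cardsT => <-.
  congr (_ * _)%N; apply: eq_bigr => c _; apply: eq_card => v.
  by rewrite !inE finset.sub1set inE.
have := @leq_sum _ (index_enum _) xpredT _ _ (fun c _ => card_edges_sample (A c)).
rewrite big_split /= -big_distrr /=.
move: sE sX sV; rewrite -/A.
set a := (\sum_c #|A c|)%N; set b := (\sum_c _)%N; set d := (\sum_c _)%N.
move=> sE sX sV le; have := card_crossing_pairs => Xn.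
have Z0 : (0 < m.+1 ^ #|V|)%N by rewrite expn_gt0.
rewrite -(leq_pmul2r Z0) mulnDl -mulnA -sE.
apply: (@leq_trans (3 * (m.+1 ^ 3 * (#|V| * m.+1 ^ #|V|)) + #|crossing_pairs| * m.+1 ^ #|V|)%N).
  by rewrite -sV -sX; move: le; nia.
by apply: leq_add; [rewrite !mulnA | rewrite leq_mul2r Xn orbT].
Qed.

End CrossingInequality.

(** * Points of large multiplicity *)
Section IncidenceBound.
Variables (R : realType) (n : nat) (f : 'I_n -> R -> R).
Hypothesis fX : cross_once f.

(** Every vertex on a curve, except the last one, is the left end of an arc. *)
Lemma card_incidences (V : finType) (px py : V -> R) :
  (forall u v, px u = px v -> py u = py v -> u = v) ->
  (\sum_v #|[set l | on f px py l v]%SET| <= #|edges f px py| + n)%N.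
Proof.
move=> inj; pose Inc := [set lv : 'I_n * V | on f px py lv.1 lv.2]%SET.
have -> : (\sum_v #|[set l | on f px py l v]%SET| = #|Inc|)%N.
  under eq_bigr do rewrite -sum1_card big_mkcond.
  rewrite exchange_big /= pair_bigA -sum1_card [RHS]big_mkcond /=.
  by apply: eq_bigr => lv _; rewrite !inE.
pose later (lv : 'I_n * V) := [exists w, on f px py lv.1 w && (px lv.2 < px w)].
rewrite -(cardsID [set lv | later lv]%SET Inc); apply: leq_add.
  apply: (@leq_card_rel _ _ _ _ (fun lv e => e.1 = lv)); last first.
    by move=> lv lv' e _ _ -> ->.
  move=> [l v]; rewrite !inE => /andP[/= lv /existsP[w0 /= w0P]].
  pose P w := on f px py l w && (px v < px w).
  case: (@arg_minP _ _ _ w0 P px w0P) => w /andP[lw vw] wmin.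
  exists (l, v, w) => //; rewrite inE /= /consecutive lv lw vw /=.
  apply/forallP => z; apply/implyP => lz; apply/negP => /andP[vz zw].
  by have := wmin z; rewrite /P lz vz leNgt zw => /(_ isT).
rewrite -[leqRHS]card_ord -cardsT.
apply: (@leq_card_rel _ _ _ _ (fun lv l => lv.1 = l)) => [[l v] _|].
  by exists l => //; rewrite inE.
move=> [l v] [l' v'] _ /[!inE] /andP[/= nl lv] /andP[/= nl' lv'] <- ll'; subst l'.
have le u w : on f px py l w -> ~~ later (l, u) -> px w <= px u.
  move=> lw; rewrite leNgt; apply: contra => uw.
  by apply/existsP; exists w; rewrite lw.
have e : px v = px v' by apply: le_anti; rewrite !le.
by congr (_, _); apply: inj => //; move: lv lv' => /eqP -> /eqP ->; rewrite e.
Qed.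

(** The crossing inequality allows [3 * m.+1] edges per vertex before any crossing
    is forced.  With twice as many incidences per point, half of them must be paid
    for by the [n ^ 2] possible crossings and the [n] ends of the curves. *)
Lemma rich_points_bound (m : nat) (s : seq (R * R)) : uniq s ->
  (forall p, p \in s -> (6 * m.+1 <= #|lines_through f p|)%N) ->
  (3 * m.+1 ^ 3 * size s <= m.+1 ^ 2 * n + n ^ 2)%N.
Proof.
move=> us rich; pose V := seq_sub s.
pose px (v : V) := (val v).1; pose py (v : V) := (val v).2.
have inj u v : px u = px v -> py u = py v -> u = v.
  rewrite /px /py => e1 e2; apply: val_inj.
  by rewrite [LHS]surjective_pairing [RHS]surjective_pairing e1 e2.
have cV : #|{: V}| = size s by rewrite card_seq_sub.
have := crossing_inequality fX inj m.
have := card_incidences inj.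
have : (#|{: V}| * (6 * m.+1) <= \sum_(v : V) #|[set l | on f px py l v]%SET|)%N.
  rewrite -sum_nat_const; apply: leq_sum => v _.
  apply: leq_trans (rich _ (valP v)) _; rewrite subset_leq_card //.
  by apply/fintype.subsetP => l; rewrite !inE /on => /eqP.
rewrite cV; set S := (\sum_v _)%N; set e := #|edges _ _ _|.
move=> h1 h2 h3; have h4 : (m.+1 ^ 2 * (size s * (6 * m.+1)) <= m.+1 ^ 2 * (e + n))%N.
  by rewrite leq_mul2l (leq_trans h1 h2) orbT.
move: h3 h4; rewrite !expnS expn0 !muln1; lia.
Qed.

End IncidenceBound.

(** * Counting pairs of pseudolines *)

Lemma card_fibers (R : numDomainType) (T : finType) (U : eqType) (B : {set T})
    (g : T -> U) (s : seq U) (K : R) :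
  (forall t, t \in B -> g t \in s) ->
  (forall p, p \in s -> #|[set t in B | g t == p]%SET|%:R <= K) ->
  #|B|%:R <= K * (size s)%:R.
Proof.
elim: s B => [|a s IH] B gs gK /=.
  have -> : B = finset.set0 by apply/setP => t; rewrite inE; apply/negP => /gs.
  by rewrite cards0 mulr0.
rewrite -(cardsID [set t | g t == a]%SET B) natrD -natr1 mulrDr mulr1 addrC lerD //.
  apply: IH => [t|p ps].
    by rewrite !inE => /andP[ta /gs]; rewrite inE (negPf ta).
  apply: le_trans (gK p _); last by rewrite inE ps orbT.
  rewrite ler_nat subset_leq_card //; apply/fintype.subsetP => t.
  by rewrite !inE => /andP[/andP[_ ->] ->].
apply: le_trans (gK a _); last by rewrite inE eqxx.
rewrite ler_nat subset_leq_card //; apply/fintype.subsetP => t.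
by rewrite !inE.
Qed.

Lemma card_rows (R : numDomainType) (n : nat) (B : {set 'I_n * 'I_n}) (K : R) :
  (forall i, #|[set j | (i, j) \in B]%SET|%:R <= K) -> #|B|%:R <= K * n%:R.
Proof.
move=> rows; rewrite -[n in leRHS]size_enum_ord.
apply: (card_fibers (g := fst)) => [t _|i _]; first by rewrite mem_enum.
apply: le_trans (rows i); rewrite ler_nat.
apply: (@leq_card_rel _ _ _ _ (fun t j => t = (i, j))) => [[i' j]|t t' j _ _ -> -> //].
by rewrite !inE /= => /andP[? /eqP <-]; exists j; rewrite ?inE.
Qed.

Section CountingPairs.
Variables (R : realType) (n : nat) (f : 'I_n -> R -> R).
Hypothesis fA : pseudoline_arrangement f.

Let fX : cross_once f := arrangement_cross_once fA.
Let mult (p : R * R) : nat := #|lines_through f p|.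

Lemma in_lines_through p l : (l \in lines_through f p) = (p.2 == f l p.1).
Proof. by rewrite inE; apply/idP/eqP => [/set_mem|/mem_set]. Qed.

Lemma meet_exists : {meet : 'I_n * 'I_n -> R * R | forall ij, ij.1 != ij.2 ->
  ij.1 \in lines_through f (meet ij) /\ ij.2 \in lines_through f (meet ij)}.
Proof.
apply: cid; suff /choice[g gP] : forall ij : 'I_n * 'I_n, exists p, ij.1 != ij.2 ->
    ij.1 \in lines_through f p /\ ij.2 \in lines_through f p by exists g.
move=> [i j] /=; have [ij|ij] := eqVneq i j; first by exists (0, 0).
have [x [e _]] := fX ij; exists (x, f i x) => _.
by rewrite !in_lines_through /= e.
Qed.

Definition meet := sval meet_exists.

Lemma meet1 ij : ij.1 != ij.2 -> ij.1 \in lines_through f (meet ij).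
Proof. by move=> /(svalP meet_exists)[]. Qed.

Lemma meet2 ij : ij.1 != ij.2 -> ij.2 \in lines_through f (meet ij).
Proof. by move=> /(svalP meet_exists)[]. Qed.

Lemma two_points_one_line i j p q : p != q ->
  i \in lines_through f p -> i \in lines_through f q ->
  j \in lines_through f p -> j \in lines_through f q -> i = j.
Proof.
rewrite !in_lines_through => pq /eqP ip /eqP iq /eqP jp /eqP jq.
apply/eqP; apply: contraNT pq => ij.
have e : p.1 = q.1 by apply: (agree_once fX ij); rewrite -?ip -?iq.
by rewrite [p]surjective_pairing [q]surjective_pairing ip iq e.
Qed.

Lemma meet_crossing ij : ij.1 != ij.2 -> crossing_point f (meet ij).
Proof.
move=> ne; rewrite /crossing_point; apply/card_gt1P; exists ij.1, ij.2.
by rewrite meet1 // meet2.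
Qed.

Lemma meet_local_sequence ij : ij.1 != ij.2 -> meet ij \in local_sequence f ij.1.
Proof.
move=> ne; rewrite mem_local_sequence //; apply: mem_set; split.
  exact: meet_crossing.
by have := meet1 ne; rewrite in_lines_through => /eqP.
Qed.

Definition pairs_meeting (Q : pred nat) : {set 'I_n * 'I_n} :=
  [set ij | (ij.1 != ij.2) && Q (mult (meet ij))]%SET.

Definition meeting_points (Q : pred nat) : seq (R * R) :=
  undup [seq meet ij | ij <- enum (pairs_meeting Q)].

Lemma mem_meeting_points Q ij :
  ij \in pairs_meeting Q -> meet ij \in meeting_points Q.
Proof. by move=> h; rewrite mem_undup map_f // mem_enum. Qed.

Lemma meeting_pointsP Q p : p \in meeting_points Q -> Q (mult p).
Proof. by rewrite mem_undup => /mapP[ij]; rewrite mem_enum inE => /andP[_ ?] ->. Qed.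

Lemma card_pairs_scale (m : nat) : (0 < m)%N ->
  #|pairs_meeting (fun k => 6 * m <= k < 12 * m)%N|%:R <=
  48 * (m%:R * n%:R + n%:R ^+ 2 / m%:R) :> R.
Proof.
case: m => // m _; set Q := (fun k => _).
have := @rich_points_bound _ _ _ fX m (meeting_points Q) (undup_uniq _).
move=> /(_ (fun p ps => proj1 (andP (meeting_pointsP ps)))).
set N := size _ => hN.
have : #|pairs_meeting Q|%:R <= (12 * m.+1%:R) ^+ 2 * N%:R :> R.
  apply: (card_fibers (g := meet)) => [t|p /meeting_pointsP /andP[_ lt]].
    exact: mem_meeting_points.
  rewrite -natrM -natrX ler_nat; apply: (@leq_trans (mult p * mult p)).
    rewrite -cardsX subset_leq_card //; apply/fintype.subsetP => -[i j].
    rewrite inE => /andP[]; rewrite inE => /andP[ij _] /eqP <-.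
    by rewrite finset.in_setX; apply/andP; split; [exact: meet1 ij|exact: meet2 ij].
  by rewrite leq_mul // ltnW.
have {}hN : 3 * m.+1%:R ^+ 3 * N%:R <= m.+1%:R ^+ 2 * n%:R + n%:R ^+ 2 :> R.
  by rewrite -!natrX -!natrM -natrD ler_nat.
have m0 : 0 < m.+1%:R :> R by rewrite ltr0n.
move: m.+1%:R m0 hN => x x0 hN hB; apply: le_trans hB _.
have -> : 48 * (x * n%:R + n%:R ^+ 2 / x) = 48 * (x ^+ 2 * n%:R + n%:R ^+ 2) / x.
  by field; rewrite gt_eqF.
by rewrite ler_pdivlMr //; move: hN; lra.
Qed.

(** The last term, which a crude bound would omit, makes the geometric sum
    telescope in the induction. *)
Lemma card_pairs_dyadic (a t : nat) :
  #|pairs_meeting (fun k => 6 * 2 ^ a <= k < 6 * 2 ^ (a + t))%N|%:R <=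
  48 * (2 ^+ (a + t) * n%:R + 2 * n%:R ^+ 2 / 2 ^+ a
        - 2 * n%:R ^+ 2 / 2 ^+ (a + t)) :> R.
Proof.
elim: t => [|t IH].
  rewrite addn0 (_ : pairs_meeting _ = finset.set0).
    by rewrite cards0 addrK mulr_ge0 ?mulr_ge0 ?exprn_ge0.
  by apply/setP => ij; rewrite !inE; apply/negP; lia.
have := @card_pairs_scale (2 ^ (a + t)).
rewrite expn_gt0 /= natrX => /(_ isT) hm.
have : (#|pairs_meeting (fun k => 6 * 2 ^ a <= k < 6 * 2 ^ (a + t.+1))%N| <=
   #|pairs_meeting (fun k => 6 * 2 ^ a <= k < 6 * 2 ^ (a + t))%N| +
   #|pairs_meeting (fun k => 6 * 2 ^ (a + t) <= k < 12 * 2 ^ (a + t))%N|)%N.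
  apply: leq_trans (leq_card_setU _ _); apply: subset_leq_card.
  apply/fintype.subsetP => ij; rewrite !inE addnS expnS; lia.
rewrite -(ler_nat R) natrD => /le_trans; apply.
apply: le_trans (lerD IH hm) _; rewrite addnS (exprS 2).
have x0 : 0 < 2 ^+ (a + t) :> R by rewrite exprn_gt0.
move: (2 ^+ (a + t)) x0 => x x0; rewrite invfM.
lra.
Qed.

End CountingPairs.

Section FinalCount.
Variables (R : realType) (n : nat) (f : 'I_n -> R -> R).
Hypothesis fA : pseudoline_arrangement f.

Lemma card_pairs_middle (a b : nat) :
  #|pairs_meeting fA (fun k => 6 * 2 ^ a <= k < 6 * 2 ^ b)%N|%:R <=
  48 * (2 ^+ b * n%:R + 2 * n%:R ^+ 2 / 2 ^+ a) :> R.
Proof.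
have [ab|ba] := leqP a b.
  rewrite -(subnKC ab); apply: le_trans (card_pairs_dyadic fA a (b - a)) _.
  by rewrite ler_pM2l // gerBl !mulr_ge0 ?invr_ge0 ?exprn_ge0.
rewrite (_ : pairs_meeting _ _ = finset.set0).
  by rewrite cards0 mulr_ge0 // addr_ge0 ?mulr_ge0 ?invr_ge0 ?exprn_ge0.
apply/setP => ij; rewrite !inE; apply/negP => /andP[_ /andP[h1 h2]].
have := leq_ltn_trans h1 h2; rewrite ltn_mul2l ltn_exp2l //=; lia.
Qed.

Lemma card_pairs_low (i : 'I_n) (k : nat) :
  (#|[set j | (i, j) \in pairs_meeting fA (fun h => h < k)%N]%SET|%:R : R)
  <= k%:R * (half_period f i)%:R.
Proof.
apply: (card_fibers (g := fun j => meet fA (i, j))) => [j|p _].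
  by rewrite !inE => /andP[ij _]; exact: (meet_local_sequence fA ij).
have [->|[j0]] := set_0Vmem [set t in [set j | (i, j) \in pairs_meeting fA (fun h => h < k)%N] |
   meet fA (i, t) == p]%SET; first by rewrite cards0.
rewrite !inE => /andP[/andP[_ lt] /eqP pE]; rewrite pE in lt.
rewrite ler_nat; apply: leq_trans (ltnW lt); apply: subset_leq_card.
apply/fintype.subsetP => j /setIdP[jS /eqP <-].
suff ij : i != j by exact: (@meet2 _ _ _ fA (i, j) ij).
by move: jS; rewrite !inE => /andP[].
Qed.

(** A pseudoline through two of the meeting points is determined by them, which gives
    the quadratic term; any other one meets all its partners at a single point, of
    multiplicity at most [D]. *)
Lemma card_pairs_high (Q : pred nat) (D : R) : 0 <= D ->
  (forall p, crossing_point f p -> #|lines_through f p|%:R <= D) ->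
  #|pairs_meeting fA Q|%:R <=
    (size (meeting_points fA Q))%:R ^+ 2 * n%:R + D * n%:R.
Proof.
move=> D0 hD; set s := meeting_points fA Q.
pose rich i (pq : (R * R) * (R * R)) := [/\ pq.1 \in s, pq.2 \in s, pq.1 != pq.2,
  i \in lines_through f pq.1 & i \in lines_through f pq.2].
pose B := [set i | `[< exists pq, rich i pq >]]%SET.
have cB : #|B|%:R <= (size s)%:R ^+ 2 :> R.
  have /choice[g gP] i : exists pq, i \in B -> rich i pq.
    have [|] := boolP (i \in B); last by exists ((0, 0), (0, 0)).
    by rewrite inE => /asboolP[pq ?]; exists pq.
  rewrite expr2 -natrM -(size_allpairs pair) -[leRHS]mul1r.
  apply: (card_fibers (g := g)) => [i /gP[ps qs _ _ _]|pq _].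
    by apply/allpairsP; exists (g i); split => //; exact: surjective_pairing.
  rewrite lern1; apply/card_le1_eqP => i j /setIdP[iB /eqP gi] /setIdP[jB /eqP gj].
  have [_ _ ne ip iq] := gP _ iB; have [_ _ _ jp jq] := gP _ jB.
  rewrite gi in ne ip iq; rewrite gj in jp jq.
  exact: (two_points_one_line fA ne jp jq ip iq).
pose A := [set ij in pairs_meeting fA Q | ij.1 \notin B]%SET.
have cA : #|A|%:R <= D * n%:R.
  apply: card_rows => i.
  have [->|[j0]] := set_0Vmem [set j | (i, j) \in A]%SET; first by rewrite cards0.
  rewrite inE => /setIdP[ij0 iB].
  have ne0 : i != j0 by move: ij0; rewrite !inE => /andP[].
  apply: le_trans (hD _ (@meet_crossing _ _ _ fA (i, j0) ne0)).
  rewrite ler_nat; apply: subset_leq_card; apply/fintype.subsetP => j.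
  rewrite [j \in [set _ | _]%SET]inE => /setIdP[ij _].
  have ne : i != j by move: ij; rewrite !inE => /andP[].
  suff -> : meet fA (i, j0) = meet fA (i, j) by exact: (@meet2 _ _ _ fA (i, j) ne).
  apply/eqP; apply: contraNT iB => pq; rewrite inE; apply/asboolP.
  exists (meet fA (i, j0), meet fA (i, j)); split=> //.
  - exact: mem_meeting_points.
  - exact: mem_meeting_points.
  - exact: (@meet1 _ _ _ fA (i, j0) ne0).
  - exact: (@meet1 _ _ _ fA (i, j) ne).
have : (#|pairs_meeting fA Q| <= #|B| * n + #|A|)%N.
  rewrite -[n in (_ * n)%N]card_ord -cardsT -cardsX.
  apply: leq_trans (leq_card_setU _ _); apply: subset_leq_card.
  apply/fintype.subsetP => -[i j] ij; rewrite !inE.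
  by move: ij; rewrite inE => -> /=; rewrite andbT orbN.
rewrite -(ler_nat R) natrD natrM => /le_trans; apply.
by rewrite lerD // ler_wpM2r.
Qed.

End FinalCount.

(** The terms count, in this order, the diagonal, the pairs starting with a rich
    pseudoline, and the remaining pairs according to the multiplicity of their
    meeting point: low, middle and high. *)
Lemma pair_count (R : realType) (n : nat) (f : 'I_n -> R -> R)
    (fA : pseudoline_arrangement f) (b D : R) (i0 i1 : nat) :
  0 <= b -> 0 <= D ->
  (forall p, crossing_point f p -> #|lines_through f p|%:R <= D) ->
  n%:R ^+ 2 <= n%:R
    + #|[set i : 'I_n | b <= (half_period f i)%:R]%SET|%:R * n%:R
    + (6 * 2 ^+ i0) * b * n%:R
    + 48 * (2 ^+ i1 * n%:R + 2 * n%:R ^+ 2 / 2 ^+ i0)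
    + ((size (meeting_points fA (fun h => 6 * 2 ^ i1 <= h)%N))%:R ^+ 2 * n%:R
       + D * n%:R).
Proof.
move=> b0 D0 hD; set Rich := [set i | _]%SET.
pose Diag := [set ij : 'I_n * 'I_n | ij.1 == ij.2]%SET.
pose Low := [set ij in pairs_meeting fA (fun h => h < 6 * 2 ^ i0)%N | ij.1 \notin Rich]%SET.
pose Mid := pairs_meeting fA (fun h => 6 * 2 ^ i0 <= h < 6 * 2 ^ i1)%N.
pose High := pairs_meeting fA (fun h => 6 * 2 ^ i1 <= h)%N.
have cDiag : #|Diag|%:R <= n%:R :> R.
  rewrite -[leRHS]mul1r; apply: card_rows => i.
  by rewrite lern1; apply/card_le1_eqP => j k; rewrite !inE /= => /eqP <- /eqP.
have cLow : #|Low|%:R <= 6 * 2 ^+ i0 * b * n%:R.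
  apply: card_rows => i; have [iR|iR] := boolP (i \in Rich).
    rewrite (_ : [set _ | _]%SET = finset.set0) ?cards0 ?mulr_ge0 ?exprn_ge0 //.
    by apply/setP => j; rewrite !inE -/Rich; rewrite inE in iR; rewrite iR andbF.
  have hp : (half_period f i)%:R <= b by move: iR; rewrite inE -ltNge => /ltW.
  apply: le_trans (_ : (6 * 2 ^ i0)%:R * (half_period f i)%:R <= _); last first.
    by rewrite natrM natrX ler_wpM2l // mulr_ge0 ?exprn_ge0.
  apply: le_trans (card_pairs_low fA i _); rewrite ler_nat; apply: subset_leq_card.
  by apply/fintype.subsetP => j; rewrite !inE => /andP[->].
have cMid := card_pairs_middle fA i0 i1; rewrite -/Mid in cMid.
have cHigh := card_pairs_high fA (fun h => 6 * 2 ^ i1 <= h)%N D0 hD; rewrite -/High in cHigh.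
have : (n ^ 2 <= #|Diag| + #|Rich| * n + #|Low| + #|Mid| + #|High|)%N.
  have -> : (n ^ 2 = #|[set: 'I_n * 'I_n]%SET|)%N by rewrite cardsT card_prod card_ord.
  rewrite -[n in (_ * n)%N]card_ord -cardsT -cardsX.
  apply: (@leq_trans #|Diag :|: finset.setX Rich [set: 'I_n] :|: Low :|: Mid :|: High|%SET); last first.
    do 4![apply: leq_trans (leq_card_setU _ _) _; rewrite leq_add2r].
    exact: leqnn.
  apply: subset_leq_card.
  apply/fintype.subsetP => -[i j] _; rewrite !finset.in_setU [_ \in Diag]inE /=.
  have [//|ij] := eqVneq i j; rewrite finset.in_setX finset.in_setT andbT.
  have [//|iR] := boolP (i \in Rich); rewrite [_ \in Low]inE /= iR andbT.
  rewrite ![_ \in pairs_meeting _ _]inE /= ij /=.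
  by case: ltnP => //= _; case: ltnP.
rewrite -(ler_nat R) natrX !natrD natrM => /le_trans; apply.
by rewrite !lerD.
Qed.

Theorem theorem9 (R : realType) (delta : R) (hdelta : 0 < delta < 1) :
  exists (a b : R) (n0 : nat), 0 < a /\ 0 < b /\
    forall n : nat, (n0 <= n)%N ->
    forall f : 'I_n -> R -> R, pseudoline_arrangement f ->
    (forall p : R * R, crossing_point f p ->
       (#|lines_through f p|)%:R <= delta * n%:R) ->
    a * n%:R <= (#|[set i : 'I_n | b * n%:R <= (half_period f i)%:R]%SET|)%:R.
Proof.
have [d0 d1] := andP hdelta.
have [eps [eps0 epsE]] : exists eps, 0 < eps /\ delta = 1 - eps.
  by exists (1 - delta); rewrite subr_gt0 subKr.
have exp_bound (x : R) : 0 <= x -> exists i : nat, x <= 2 ^+ i.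
  move=> /archi_boundP/ltW h; exists (Num.bound x); apply: le_trans h _.
  by rewrite -natrX ler_nat ltnW // ltn_expl.
have [i0 hi0] := exp_bound (768 / eps) (divr_ge0 (ler0n _ 768) (ltW eps0)).
(* The middle range runs from [2 ^ i0] to about [c * n]; [i0] and [c] are such that
   each of its two ends contributes at most [eps / 8 * n ^ 2].  The number of points
   above the middle range will be at most [M], and [K] is the multiplicity below
   which a point counts as low. *)
have [c [c0 cE]] : exists c, 0 < c /\ 384 * c = eps.
  exists (eps / 384); split; first by rewrite divr_gt0 ?ltr0n.
  by rewrite mulrC divfK ?pnatr_eq0.
have [M [M0 ME]] : exists M, 0 <= M /\ M = 2 / (3 * c) + 8 / (3 * c ^+ 3).
  exists (2 / (3 * c) + 8 / (3 * c ^+ 3)); split=> //.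
  by apply: addr_ge0; apply: divr_ge0; rewrite ?ler0n // pmulr_rge0 ?ltr0n // ?exprn_ge0 // ltW.
have [K [K0 KE]] : exists K : R, 0 < K /\ K = 6 * 2 ^+ i0.
  by exists (6 * 2 ^+ i0); split=> //; rewrite pmulr_rgt0 ?exprn_gt0 ?ltr0n.
pose x0 := c^-1 + 2 * (M ^+ 2 + 1) / eps.
have x00 : 0 <= x0.
  apply: addr_ge0; first by rewrite invr_ge0 ltW.
  by apply: divr_ge0; [rewrite mulr_ge0 ?addr_ge0 ?sqr_ge0 | rewrite ltW].
exists (eps / 8), (eps / (8 * K)), (Num.bound x0).+1.
split; first by rewrite divr_gt0.
split; first by rewrite divr_gt0 ?mulr_gt0.
move=> n hn f fA hf.
set x : R := n%:R.
have xx0 : x0 < x.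
  by apply: lt_le_trans (archi_boundP x00) _; rewrite ler_nat ltnW.
have x1 : 1 <= x by rewrite ler1n (leq_trans _ hn).
have x_ge0 : 0 <= x := le_trans ler01 x1.
have hcx : 1 < c * x.
  have : c^-1 < x.
    apply: le_lt_trans xx0; rewrite lerDl divr_ge0 ?(ltW eps0) //.
    by rewrite mulr_ge0 ?addr_ge0 ?exprn_ge0.
  by rewrite mulrC -ltr_pdivrMr // div1r.
have hMx : 2 * (M ^+ 2 + 1) < eps * x.
  have : 2 * (M ^+ 2 + 1) / eps < x.
    by apply: le_lt_trans xx0; rewrite lerDr invr_ge0 ltW.
  by rewrite ltr_pdivrMr // (mulrC x).
have [i1 [y1 y2]] : exists i : nat, 2 ^+ i <= c * x /\ c * x <= 2 * 2 ^+ i :> R.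
  have /andP[t1 t2] := truncn_itv (ltW (lt_trans ltr01 hcx)).
  have t0 : (0 < Num.truncn (c * x))%N by rewrite truncn_gt0 ltW.
  exists (trunc_log 2 (Num.truncn (c * x))); split.
    by apply: le_trans t1; rewrite -natrX ler_nat trunc_logP.
  by apply: le_trans (ltW t2) _; rewrite -exprS -natrX ler_nat trunc_log_ltn.
set Rich := [set i | _]%SET; rewrite leNgt; apply/negP => poor.
have bx0 : 0 <= eps / (8 * K) * x.
  by rewrite mulr_ge0 ?divr_ge0 ?(ltW eps0) // mulr_ge0 // ltW.
have := pair_count fA i0 i1 bx0 (mulr_ge0 (ltW d0) (ler0n R n)) hf.
rewrite -/Rich -/x -KE; set y := 2 ^+ i1 in y1 y2 *.
have y0 : 0 < y by rewrite exprn_gt0.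
set s := meeting_points _ _; set r := #|Rich|%:R.
(* As [2 ^ i1] is comparable to [c * n], the number of high points is bounded
   independently of [n]. *)
have hs : (size s)%:R <= M.
  have [m mE] : exists m, (2 ^ i1 = m.+1)%N.
    by exists (2 ^ i1).-1; rewrite prednK // expn_gt0.
  have := @rich_points_bound _ _ _ (arrangement_cross_once fA) m s (undup_uniq _).
  rewrite -mE => /(_ (fun p ps => meeting_pointsP ps)).
  move=> hs; have {hs} : 3 * y ^+ 3 * (size s)%:R <= y ^+ 2 * x + x ^+ 2 :> R.
    by rewrite /y /x -!natrX -!natrM -natrD ler_nat.
  have xy : x <= 2 / c * y by rewrite mulrAC ler_pdivlMr // mulrC.
  have h1 : y ^+ 2 * x <= 2 / c * y ^+ 3.
    by rewrite (exprSr y 2) mulrCA ler_wpM2l ?exprn_ge0 // ltW.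
  have h2 : x ^+ 2 <= 8 / c ^+ 3 * y ^+ 3.
    apply: (@le_trans _ _ (x ^+ 3)); first by rewrite ler_weXn2l.
    have -> : 8 / c ^+ 3 * y ^+ 3 = (2 / c * y) ^+ 3 by field; rewrite gt_eqF.
    by rewrite lerXn2r ?nnegrE // (le_trans x_ge0 xy).
  move=> h; rewrite -(ler_pM2l (_ : 0 < 3 * y ^+ 3)) ?mulr_gt0 ?exprn_gt0 //.
  apply: (le_trans h); apply: le_trans (lerD h1 h2) _.
  by rewrite le_eqVlt; apply/orP; left; apply/eqP; rewrite ME; field; rewrite gt_eqF.
have hs2 : (size s)%:R ^+ 2 * x <= M ^+ 2 * x.
  by rewrite ler_wpM2r // lerXn2r ?nnegrE.
have hr : r * x <= eps / 8 * x * x.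
  by rewrite ler_wpM2r // ltW.
have hK : K * (eps / (8 * K) * x) * x = eps / 8 * x * x by field; rewrite gt_eqF.
have hy : y * x <= c * x * x by rewrite ler_wpM2r.
have hi : 2 * x ^+ 2 / 2 ^+ i0 <= c * x ^+ 2.
  have p0 : 0 < 2 ^+ i0 :> R by rewrite exprn_gt0.
  rewrite ler_pdivrMr // mulrAC ler_wpM2r ?exprn_ge0 //.
  by move: hi0; rewrite ler_pdivrMr // -cE; lra.
have hM : 2 * (M ^+ 2 + 1) * x < eps * x * x by rewrite ltr_pM2r ?(lt_le_trans ltr01 x1).
(* Rich, low and middle pairs contribute at most [eps / 2 * x ^+ 2] in total, in
   four equal parts, two of which come from the middle range. *)
rewrite hK; move: hs2 hr hy hi hM; rewrite epsE -cE !expr2; lra.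
Qed.
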